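(* Let $X=\{X_0,X_1,\ldots\}$ be a stationary ($X_0\sim\pi$) Harris ergodic Markov chain on $\mathsf{X}$ with invariant distribution $\pi$ and $n$-step kernels $P^n$. Suppose there exist a probability measure $\phi$ on $\mathsf{X}$, $\lambda>0$ and an integer $n_0\ge1$ such that $P^{n_0}(x,\cdot)\ge\lambda\phi(\cdot)$ for each $x\in\mathsf{X}$. Then for every $\epsilon>0$ and $0<\delta<1$, \[ \Pr\left(|\hat{\xi}_{n,q}-\xi_q|>\epsilon\right)\le 2\exp\left\{-\frac{\lambda^2(n\gamma-2n_0/\lambda)^2}{2nn_0^2}\right\} \] for $n>2n_0/(\lambda\gamma)$, where $\gamma=\min\{F_V(\xi_q+\epsilon)-q,\ \delta(q-F_V(\xi_q-\epsilon))\}$.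
   Context: $\pi$ is a probability distribution with support $\mathsf{X}\subseteq\mathbb{R}^d$, $d\ge1$; $\mathcal{B}(\mathsf{X})$ is the Borel $\sigma$-algebra; $P^n(x,A)=\Pr(X_{k+n}\in A\mid X_k=x)$. Harris ergodic means $\pi$-irreducible, aperiodic and positive Harris recurrent. The function $g:\mathsf{X}\to\mathbb{R}$ is measurable, $V=g(W)$ with $W\sim\pi$, $F_V$ is the distribution function of $V$, $0<q<1$, and $\xi_q=\inf\{v:F_V(v)\ge q\}$. It is assumed that $F_V$ is absolutely continuous with continuous density $f_V$ satisfying $0<f_V(\xi_q)<\infty$. Set $Y_i=g(X_i)$, let $Y_{n(j)}$ be the $j$th order statistic of $Y_0,\ldots,Y_{n-1}$, and $\hat{\xi}_{n,q}=Y_{n(j)}$ where $j$ is the integer with $j-1<nq\le j$. *)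

(* Defs.v *)
From HB Require Import structures.
From mathcomp Require Import all_boot all_order all_algebra.
From mathcomp Require Import all_classical all_reals all_analysis.

Set Implicit Arguments.
Unset Strict Implicit.
Unset Printing Implicit Defensive.

Import Order.TTheory GRing.Theory Num.Theory.
Import numFieldNormedType.Exports.

Local Open Scope classical_set_scope.
Local Open Scope ring_scope.

Definition borel (T : ptopologicalType) := g_sigma_algebraType (@open T).

Definition measure_support (R : realType) (T : ptopologicalType)
    (mu : {measure set (borel T) -> \bar R}) : set T :=
  [set x | forall U : set T, open U -> U x -> (0 < mu U)%E].

(* A subset X of R^d with its subspace topology. A measurable type must be
   pointed, so the carrier also records a point x0 of X; nothing else depends
   on the choice of x0. *)
Definition subset_space (R : realType) (d : nat) (X : set 'rV[R]_d) (x0 : X) :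
  Type := set_type X.

HB.instance Definition _ (R : realType) (d : nat) (X : set 'rV[R]_d) (x0 : X) :=
  Topological.copy (subset_space x0) (set_type X).
HB.instance Definition _ (R : realType) (d : nat) (X : set 'rV[R]_d) (x0 : X) :=
  isPointed.Build (subset_space x0) x0.

Section Kernels.
Context (disp : measure_display) (S : measurableType disp) (R : realType).
Variables (P : R.-pker S ~> S) (pi : probability S R).
Local Open Scope ereal_scope.

Fixpoint kpow (n : nat) : R.-spker S ~> S :=
  if n is m.+1 then mkcomp_noparam P (kpow m)
  else kdirac (@measurable_id _ S setT).

Definition invariant_distribution : Prop :=
  forall A : set S, measurable A -> \int[pi]_x P x A = pi A.

Definition irreducible : Prop :=
  forall (x : S) (A : set S), measurable A -> 0 < pi A ->
    exists2 n : nat, (0 < n)%N & 0 < kpow n x A.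

Definition cycle_of_sets (m : nat) (D : nat -> set S) : Prop :=
  [/\ forall i : nat, measurable (D i),
      trivIset `I_m D,
      pi (~` \bigcup_(i in `I_m) D i) = 0 &
      forall (i : nat) (x : S),
        (i < m)%N -> D i x -> P x (D (i.+1 %% m)%N) = 1].

Definition aperiodic : Prop :=
  forall (m : nat) (D : nat -> set S), cycle_of_sets m D -> (m <= 1)%N.

Section Process.
Context (dO : measure_display) (O : measurableType dO) (Pr : probability O R).
Variable X : nat -> {RV Pr >-> S}.

(* sigma(X_0, ..., X_n) *)
Definition history (n : nat) : set (set O) :=
  <<s [set B | exists (i : nat) (A : set S),
    [/\ (i <= n)%N, measurable A & B = X i @^-1` A]] >>.

(* Pr(X_{n+1} \in A | X_0, ..., X_n) = P(X_n, A) almost surely, with the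
   conditional probability characterized by its integrals over the events of
   the history. *)
Definition markov_chain : Prop :=
  forall (n : nat) (A : set S) (B : set O), measurable A -> history n B ->
    Pr (B `&` X n.+1 @^-1` A) = \int[Pr]_(w in B) P (X n w) A.

Definition initial_law (nu : {measure set S -> \bar R}) : Prop :=
  forall A : set S, measurable A -> distribution Pr (X 0%N) A = nu A.

End Process.

(* Pr_x(X_n \in A infinitely often) = 1 for every x and every A with
   pi(A) > 0. The law Pr_x of the chain started at x is represented by all
   realizations of that chain, on arbitrary probability spaces. *)
Definition harris_recurrent : Prop :=
  forall (A : set S) (x : S), measurable A -> 0 < pi A ->
  forall (dO : measure_display) (O : measurableType dO) (Pr : probability O R)
    (X : nat -> {RV Pr >-> S}),
    markov_chain X -> initial_law X \d_x ->
    Pr (lim_sup_set (fun n => X n @^-1` A)) = 1.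

(* The invariant probability pi makes the Harris recurrent chain positive. *)
Definition harris_ergodic : Prop :=
  [/\ irreducible, aperiodic, harris_recurrent & invariant_distribution].

Definition minorized (n0 : nat) (lambda : R) (phi : probability S R) : Prop :=
  forall (x : S) (A : set S), measurable A ->
    lambda%:E * phi A <= kpow n0 x A.

End Kernels.

Section Quantiles.
Context (disp : measure_display) (S : measurableType disp) (R : realType).
Variables (pi : probability S R) (g : {RV pi >-> R}).

(* F_V for V = g(W), W ~ pi *)
Definition dfun (v : R) : R := fine (cdf g v).

(* F_V is absolutely continuous with density f *)
Definition has_density (f : R -> R) : Prop :=
  (forall t : R, 0 <= f t) /\
  (forall v : R,
    (dfun v)%:E = \int[lebesgue_measure]_(t in `]-oo, v]) (f t)%:E)%E.

Definition quantile (q : R) : R := inf [set v : R | q <= dfun v].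

End Quantiles.

Section SampleQuantile.
Context (R : realType) (O : Type) (Y : nat -> O -> R).

(* j-th smallest value, j = 1, ..., n, among Y_0(w), ..., Y_{n-1}(w) *)
Definition order_statistic (n j : nat) (w : O) : R :=
  nth 0 (sort <=%R [seq Y i w | i <- iota 0 n]) j.-1.

Definition quantile_index (n : nat) (q : R) : nat := `|Num.ceil (n%:R * q)|%N.

Definition sample_quantile (n : nat) (q : R) (w : O) : R :=
  order_statistic n (quantile_index n q) w.

End SampleQuantile.

Lemma quantile_indexP (R : realType) (n : nat) (q : R) : 0 < q ->
  let j := (quantile_index n q)%:R in j - 1 < n%:R * q <= j.
Proof.
move=> q0 /=; have nq0 : 0 <= n%:R * q by rewrite mulr_ge0 ?ler0n// ltW.
have c0 : 0 <= Num.ceil (n%:R * q) by rewrite ceil_ge0 (lt_le_trans _ nq0).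
have := ceil_itv (n%:R * q).
by rewrite intrB /quantile_index natr_absz ger0_norm.
Qed.

(* Main.v *)
Require Import Defs.
From HB Require Import structures.
From mathcomp Require Import all_boot all_order all_algebra.
From mathcomp Require Import all_classical all_reals all_analysis.
From mathcomp Require Import ring lra.
(* Imported last so that \bar R is inferred as a measurable type. *)
From mathcomp Require Import measurable_realfun.

Set Implicit Arguments.
Unset Strict Implicit.
Unset Printing Implicit Defensive.

Import Order.TTheory GRing.Theory Num.Theory.
Import numFieldNormedType.Exports.

Local Open Scope classical_set_scope.
Local Open Scope ring_scope.

(** The event that the sample quantile misses the quantile [xi] by more than
[eps] is a statement about two occupation counts. With [j] the index of the
order statistic, [sq > xi + eps] means that fewer than [j] of the [n] values are
at most [xi + eps], so the chain visits [{g > xi + eps}] at least [n - j + 1]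
times, although the stationary mean of that count is only
[n (1 - F_V (xi + eps))]; similarly [sq < xi - eps] means at least [j] visits to
[{g < xi - eps}]. Since [j - 1 < n q <= j], either count exceeds its mean by at
least [n gamma]. Everything thus reduces to a Hoeffding inequality for the
number [N] of visits of a stationary chain to a set [A] up to time [n]
([visits_concentration]).

For that inequality let [H m x] be the expected number of visits to [A] during
the first [m] steps from [x] ([expected_visits]). The minorization makes
[P^n0] shrink oscillations by the factor [1 - lambda] ([doeblin_contraction]).
Hence, by splitting off the first [n0] steps, every [H m] has oscillation at
most [n0 + (1 - lambda) (n0 / lambda) = n0 / lambda =: c]
([expected_visits_osc]). Since [H (m+1) x = 1_A x + (P (H m)) x], conditioning on
one step at a time and applying Hoeffding's lemma to [H] under each [P (x, .)]
([hoeffding_mgf]) gives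

  [E exp (s N) <= exp (s n pi(A) + n (s c)^2 / 2)]

([visits_mgf_history], [visits_mgf]), and the Chernoff bound with
[s = gamma / c^2] yields
[Pr (N >= n (pi(A) + gamma)) <= exp (- n gamma^2 / (2 c^2))].

Keeping the horizon [m] finite replaces the solution of the Poisson equation
by [H m] and produces no boundary terms, so this bound is slightly stronger than
the stated one: [0 < n gamma - 2 c < n gamma] for the values of [n] considered.

That [gamma] is positive uses that the density is continuous and positive at
[xi], so that [F_V] increases strictly to the right of [xi]
([dfun_gt_quantile]). *)

(** * Mixtures of measures and powers of a kernel *)

Section Mixtures.
Local Open Scope ereal_scope.
Import HBNNSimple.

(** An integral against a mixture of measures depends on the mixture only
through the numbers [\int[mu]_(x in D) k x A]: approximating [u] from below by
simple functions, it is the limit of sums in which nothing else occurs. *)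
Lemma integral_mixture_cvg d d' (T : measurableType d) (S : measurableType d')
    (R : realType) (mu : {measure set T -> \bar R}) (D : set T)
    (k : T -> {measure set S -> \bar R}) (u : S -> \bar R)
    (mfu : measurable_fun [set: S] u) :
  measurable D ->
  (forall A, measurable A -> measurable_fun [set: T] (k ^~ A)) ->
  (forall y, 0 <= u y) ->
  let h := nnsfun_approx measurableT mfu in
  (fun n => \sum_(r \in range (h n))
     r%:E * \int[mu]_(x in D) k x (h n @^-1` [set r])) @ \oo -->
  \int[mu]_(x in D) \int[k x]_y u y.
Proof.
move=> mD mk u0 h.
have mkD A : measurable A -> measurable_fun D (k ^~ A).
  by move=> /mk; exact: measurable_funTS.
have simple n x : \int[k x]_y (h n y)%:E =
    \sum_(r \in range (h n)) r%:E * k x (h n @^-1` [set r]).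
  by rewrite integralT_nnsfun sintegralE.
have -> : (fun n => \sum_(r \in range (h n))
     r%:E * \int[mu]_(x in D) k x (h n @^-1` [set r])) =
   (fun n => \int[mu]_(x in D) \int[k x]_y (h n y)%:E).
  apply/funext => n; under [RHS]eq_integral do rewrite simple.
  rewrite ge0_integral_fsum//; last 2 first.
  - by move=> r; apply: measurable_funeM; exact: mkD.
  - by move=> r x _; have := mulemu_ge0 (fun r => h n @^-1` [set r]);
      apply => ?; rewrite preimage_nnfun0.
  apply: eq_fsbigr => r _.
  have [r0|r0] := leP 0%R r; first by rewrite ge0_integralZl//; exact: mkD.
  rewrite integral0_eq ?mule0 ?integral0_eq//.
  - by move=> x _; rewrite preimage_nnfun0// measure0 mule0.
  - by move=> x _; rewrite preimage_nnfun0// measure0.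
have -> : \int[mu]_(x in D) \int[k x]_y u y =
    \int[mu]_(x in D) limn (fun n => \int[k x]_y (h n y)%:E).
  apply: eq_integral => x _; rewrite -monotone_convergence//.
  - by apply: eq_integral => y _; apply/esym/cvg_lim => //; exact: cvg_nnsfun_approx.
  - by move=> n; exact/measurable_EFinP.
  - by move=> n y _; rewrite lee_fin.
  - by move=> y _ a b ab; rewrite lee_fin; exact/lefP/nd_nnsfun_approx.
apply: cvg_monotone_convergence => //.
- move=> n; apply: measurable_funTS.
  apply: measurable_fun_integral_kernel => //.
  + by move=> y; rewrite lee_fin.
  + exact/measurable_EFinP.
- by move=> n x _; apply: integral_ge0 => y _; rewrite lee_fin.
- move=> x _ a b ab; apply: ge0_le_integral => //.
  + by move=> y _; rewrite lee_fin.
  + exact/measurable_EFinP.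
  + exact/measurable_EFinP.
  + by move=> y _; rewrite lee_fin; exact/lefP/nd_nnsfun_approx.
Qed.

(** The tool that extends set-wise identities between kernels (invariance, the
Markov property, composition of kernels) to nonnegative integrands. A plain
integral is the case of Dirac kernels. *)
Lemma eq_integral_mixture d1 d2 d' (T1 : measurableType d1)
    (T2 : measurableType d2) (S : measurableType d') (R : realType)
    (mu1 : {measure set T1 -> \bar R}) (mu2 : {measure set T2 -> \bar R})
    (D1 : set T1) (D2 : set T2)
    (k1 : T1 -> {measure set S -> \bar R})
    (k2 : T2 -> {measure set S -> \bar R}) (u : S -> \bar R) :
  measurable D1 -> measurable D2 ->
  (forall A, measurable A -> measurable_fun [set: T1] (k1 ^~ A)) ->
  (forall A, measurable A -> measurable_fun [set: T2] (k2 ^~ A)) ->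
  measurable_fun [set: S] u -> (forall y, 0 <= u y) ->
  (forall A, measurable A ->
    \int[mu1]_(x in D1) k1 x A = \int[mu2]_(x in D2) k2 x A) ->
  \int[mu1]_(x in D1) \int[k1 x]_y u y = \int[mu2]_(x in D2) \int[k2 x]_y u y.
Proof.
move=> mD1 mD2 mk1 mk2 mfu u0 E.
have C1 := integral_mixture_cvg (mu := mu1) mfu mD1 mk1 u0.
have C2 := integral_mixture_cvg (mu := mu2) mfu mD2 mk2 u0.
apply: (cvg_unique _ C1); rewrite //.
apply: cvg_trans C2; apply: near_eq_cvg; near=> n.
apply: eq_fsbigr => r _; rewrite E//.
Unshelve. all: by end_near. Qed.

Lemma measurable_dirac_comp d d' (T : measurableType d) (S : measurableType d')
    (R : realType) (X : T -> S) (A : set S) :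
  measurable_fun [set: T] X -> measurable A ->
  measurable_fun [set: T] (fun x => \d_(X x) A : \bar R).
Proof.
by move=> mX mA; exact: (measurable_kernel (kdirac mX : R.-ker T ~> S) A mA).
Qed.

Lemma integral_bind d d' (T : measurableType d) (S : measurableType d')
    (R : realType) (mu : {measure set T -> \bar R})
    (k : T -> {measure set S -> \bar R}) (nu : {measure set S -> \bar R})
    (u : S -> \bar R) :
  (forall A, measurable A -> measurable_fun [set: T] (k ^~ A)) ->
  measurable_fun [set: S] u -> (forall y, 0 <= u y) ->
  (forall A, measurable A -> nu A = \int[mu]_x k x A) ->
  \int[nu]_y u y = \int[mu]_x \int[k x]_y u y.
Proof.
move=> mk mfu u0 E.
transitivity (\int[nu]_x \int[\d_x]_y u y).
  by apply: eq_integral => x _; rewrite integral_dirac// diracT mul1e.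
apply: eq_integral_mixture => //.
  by move=> A mA; apply: (@measurable_dirac_comp _ _ S S R id).
by move=> A mA; rewrite -E// [LHS]integral_indic// setIT.
Qed.

End Mixtures.

Section KernelPowers.
Context (disp : measure_display) (S : measurableType disp) (R : realType).
Variable P : R.-pker S ~> S.
Local Open Scope ereal_scope.

Lemma kpowS n x A : kpow P n.+1 x A = \int[P x]_y kpow P n y A.
Proof. by []. Qed.

Lemma kpow0 x A : kpow P 0 x A = \d_x A.
Proof. by []. Qed.

Lemma kpow_setT n x : kpow P n x setT = 1.
Proof.
elim: n x => [|n IH] x; first by rewrite kpow0 diracT.
rewrite kpowS; under eq_integral do rewrite IH.
by rewrite integral_cst// mul1e prob_kernel.
Qed.

(** The Chapman-Kolmogorov equation. *)
Lemma kpowD m n x A : measurable A ->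
  kpow P (m + n) x A = \int[kpow P m x]_y kpow P n y A.
Proof.
move=> mA; elim: m x => [|m IH] x.
  by rewrite integral_dirac//; [rewrite diracT mul1e|exact: measurable_kernel].
rewrite addSn kpowS.
under eq_integral do rewrite IH.
apply/esym/integral_bind => //.
- by move=> B mB; exact: measurable_kernel.
- exact: measurable_kernel.
Qed.

Lemma invariant_kpow (pi : probability S R) n A : invariant_distribution P pi ->
  measurable A -> \int[pi]_x kpow P n x A = pi A.
Proof.
move=> piP mA; elim: n => [|n <-].
  by rewrite [LHS]integral_indic// setIT.
apply/esym/integral_bind => //.
- by move=> B mB; exact: measurable_kernel.
- exact: measurable_kernel.
- by move=> B mB; rewrite piP.
Qed.

End KernelPowers.

(** * Doeblin contraction and the oscillation of expected visits *)

Section BoundedFunctions.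
Context d (T : measurableType d) (R : realType).

Lemma integrable_le_cst (mu : {measure set T -> \bar R}) (v : T -> R) (M : R) :
  mu setT = 1%E -> measurable_fun [set: T] v -> (forall x, `|v x| <= M) ->
  mu.-integrable setT (EFin \o v).
Proof.
move=> mu1 mv vM; apply: measurable_bounded_integrable => //.
  by rewrite mu1 ltry.
by exists M; split; [exact: num_real|move=> N MN x _; exact: le_trans (ltW MN)].
Qed.

Lemma osc_bounded (v : T -> R) (c : R) : (forall x y, v x - v y <= c) ->
  forall x, `|v x| <= `|v point| + c.
Proof.
move=> vc x; have := vc x point; have := vc point x.
have := ler_norm (v point); have := ler_norm (- v point); rewrite normrN.
by move=> ? ? ? ?; rewrite ler_norml; apply/andP; split; lra.
Qed.

Lemma minorized_Rintegral (mu : {measure set T -> \bar R})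
    (phi : probability T R) (lambda : R) (w : T -> R) (M : R) :
  0 <= lambda -> mu setT = 1%E ->
  (forall A, measurable A -> (lambda%:E * phi A <= mu A)%E) ->
  measurable_fun [set: T] w -> (forall x, 0 <= w x <= M) ->
  lambda * \int[phi]_x w x <= \int[mu]_x w x.
Proof.
move=> l0 mu1 lmu mw wM.
have w0 x : 0 <= w x by case/andP: (wM x).
have wM' x : `|w x| <= M by rewrite ger0_norm//; case/andP: (wM x).
have iw := integrable_le_cst mu1 mw wM'.
have iw' := integrable_le_cst (probability_setT phi) mw wM'.
rewrite -lee_fin EFinM /Rintegral !fineK; [|exact: integrable_fin_num..].
rewrite -[lambda]/((NngNum l0)%:num) -ge0_integral_mscale//; last 2 first.
- exact/measurable_EFinP.
- by move=> x _; rewrite lee_fin.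
apply: ge0_le_measure_integral => //.
exact/measurable_EFinP.
Qed.

(** Both measures contain the common part [lambda phi], which contributes
equally to the two integrals; the remaining parts have mass [1 - lambda], and a
function of oscillation [c] cannot separate them by more than
[(1 - lambda) c]. Subtraction of measures is avoided by applying the
minorization to the nonnegative functions [v - a] and [b - v], with [a] the
infimum of [v] and [b = a + c]. *)
Lemma doeblin_contraction (mu1 mu2 : {measure set T -> \bar R})
    (phi : probability T R) (lambda : R) (v : T -> R) (c : R) :
  0 <= lambda -> mu1 setT = 1%E -> mu2 setT = 1%E ->
  (forall A, measurable A -> (lambda%:E * phi A <= mu1 A)%E) ->
  (forall A, measurable A -> (lambda%:E * phi A <= mu2 A)%E) ->
  measurable_fun [set: T] v -> (forall x y, v x - v y <= c) ->
  \int[mu1]_x v x - \int[mu2]_x v x <= (1 - lambda) * c.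
Proof.
move=> l0 mu1T mu2T lmu1 lmu2 mv vc.
have vM := osc_bounded vc.
have phiT : (phi : {measure set T -> \bar R}) setT = 1%E := probability_setT phi.
have iv (mu : {measure set T -> \bar R}) : mu setT = 1%E ->
  mu.-integrable setT (EFin \o v) by move=> muT; exact: (integrable_le_cst muT mv vM).
have ic (mu : {measure set T -> \bar R}) a : mu setT = 1%E ->
    mu.-integrable setT (EFin \o (fun=> a)).
  by move=> muT; apply: (integrable_le_cst muT (M := `|a|)).
pose a := inf (range v); pose b := a + c.
have rv0 : range v !=set0 by exists (v point); exists point.
have va x : a <= v x.
  apply: ge_inf; last by exists x.
  by exists (v x - c) => _ [y _ <-]; rewrite lerBlDr -lerBlDl.
have vb x : v x <= b.
  rewrite -lerBlDr; apply: lb_le_inf => // _ [y _ <-].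
  by rewrite lerBlDr -lerBlDl.
have lo : lambda * (\int[phi]_x v x - a) <= \int[mu2]_x v x - a.
  have := @minorized_Rintegral mu2 phi lambda (fun x => v x - a) c.
  rewrite !RintegralB//; last 4 first.
  - exact: iv. - exact: ic. - exact: iv.
  - exact: ic.
  rewrite !Rintegral_cst// phiT mu2T !mulr1; apply => //.
  - exact: measurable_funB.
  - by move=> x; rewrite subr_ge0 va lerBlDl vb.
have hi : lambda * (b - \int[phi]_x v x) <= b - \int[mu1]_x v x.
  have := @minorized_Rintegral mu1 phi lambda (fun x => b - v x) c.
  rewrite !RintegralB//; last 4 first.
  - exact: ic. - exact: iv. - exact: ic.
  - exact: iv.
  rewrite !Rintegral_cst// phiT mu1T !mulr1; apply => //.
  - exact: measurable_funB.
  - by move=> x; rewrite subr_ge0 vb lerBlDr addrC /b lerD2r va.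
by rewrite /b in hi; nra.
Qed.

End BoundedFunctions.

Section ExpectedVisits.
Context (disp : measure_display) (S : measurableType disp) (R : realType).
Variable P : R.-pker S ~> S.
Variables (A : set S) (mA : measurable A).

(** The truncation at [m] of the potential of [A] under [P]; it plays
the part of a solution of the Poisson equation. *)
Definition expected_visits (m : nat) (x : S) : R :=
  \sum_(k < m) fine (kpow P k x A).

Lemma kpow_le1 k x : (kpow P k x A <= 1)%E.
Proof. by rewrite -(kpow_setT P k x) le_measure// inE. Qed.

Lemma kpow_fin_num k x : kpow P k x A \is a fin_num.
Proof. by rewrite ge0_fin_numE// (le_lt_trans (kpow_le1 _ _)) ?ltry. Qed.

Lemma fine_kpow_itv k x : 0 <= fine (kpow P k x A) <= 1.
Proof.
by rewrite fine_ge0//= -lee_fin fineK ?kpow_fin_num// kpow_le1.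
Qed.

Lemma measurable_fine_kpow k :
  measurable_fun [set: S] (fun x => fine (kpow P k x A)).
Proof. by apply: measurableT_comp => //; exact: measurable_kernel. Qed.

Lemma measurable_expected_visits m :
  measurable_fun [set: S] (expected_visits m).
Proof. by apply: measurable_sum => k; exact: measurable_fine_kpow. Qed.

Lemma expected_visits_itv m x : 0 <= expected_visits m x <= m%:R.
Proof.
apply/andP; split.
  by apply: sumr_ge0 => k _; case/andP: (fine_kpow_itv k x).
rewrite -[leRHS]mulr1 mulr_natl -[m in leRHS]card_ord -sumr_const.
by apply: ler_sum => k _; case/andP: (fine_kpow_itv k x).
Qed.

Lemma norm_expected_visits m x : `|expected_visits m x| <= m%:R.
Proof. by have /andP[h0 hm] := expected_visits_itv m x; rewrite ger0_norm. Qed.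

Lemma Rintegral_expected_visits (mu : {measure set S -> \bar R}) m :
  mu setT = 1%E ->
  \int[mu]_x expected_visits m x =
  \sum_(k < m) fine (\int[mu]_x kpow P k x A)%E.
Proof.
move=> mu1; elim: m => [|m IH].
  under eq_Rintegral do rewrite /expected_visits big_ord0.
  by rewrite Rintegral_cst// mul0r big_ord0.
under eq_Rintegral do rewrite /expected_visits big_ord_recr/=.
rewrite RintegralD//.
- rewrite IH big_ord_recr/=; congr (_ + fine _); apply: eq_integral => x _.
  by rewrite fineK// kpow_fin_num.
- apply: (integrable_le_cst mu1 (measurable_expected_visits m)).
  exact: norm_expected_visits.
- apply: (integrable_le_cst mu1 (measurable_fine_kpow m) (M := 1)) => x.
  by have /andP[? ?] := fine_kpow_itv m x; rewrite ger0_norm.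
Qed.

Lemma expected_visitsD m n x : expected_visits (m + n) x =
  expected_visits m x + \int[kpow P m x]_y expected_visits n y.
Proof.
rewrite Rintegral_expected_visits ?kpow_setT// /expected_visits big_split_ord/=.
by congr (_ + _); apply: eq_bigr => k _; rewrite kpowD.
Qed.

Lemma expected_visitsS n x : expected_visits n.+1 x =
  \1_A x + \int[P x]_y expected_visits n y.
Proof.
rewrite Rintegral_expected_visits ?prob_kernel// /expected_visits.
by rewrite big_ord_recl/=; congr (_ + _).
Qed.

(** The first [n0] steps contribute at most [n0] to the difference. The
remaining ones contribute [P^n0 (H (m - n0))], whose oscillation is
[1 - lambda] times that of [H (m - n0)], and [n0 / lambda] is the fixed point of
[z |-> n0 + (1 - lambda) z]. *)
Lemma expected_visits_osc n0 lambda (phi : probability S R) :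
  0 < lambda -> (0 < n0)%N -> minorized P n0 lambda phi ->
  forall m x y, expected_visits m x - expected_visits m y <= n0%:R / lambda.
Proof.
move=> l0 n0_gt0 Pmin.
have l1 : lambda <= 1.
  have := Pmin point setT measurableT.
  by rewrite probability_setT kpow_setT mule1 lee_fin.
have osc_le m x y : expected_visits m x - expected_visits m y <= m%:R.
  have /andP[_ ?] := expected_visits_itv m x.
  have /andP[? _] := expected_visits_itv m y.
  lra.
elim/ltn_ind => m IH x y; have [mn0|n0m] := leqP m n0.
  apply: (le_trans (osc_le _ _ _)); rewrite ler_pdivlMr//.
  by rewrite (le_trans _ (_ : m%:R <= _)) ?ler_nat// ler_piMr.
rewrite -(subnKC (ltnW n0m)) !expected_visitsD.
have := doeblin_contraction (ltW l0) (kpow_setT P n0 x) (kpow_setT P n0 y)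
  (Pmin x) (Pmin y) (measurable_expected_visits (m - n0)) (IH (m - n0)%N _).
rewrite ltn_subrL n0_gt0 (leq_trans _ n0m)//= => /(_ isT) => contr.
have := osc_le n0 x y.
have -> : n0%:R / lambda = n0%:R + (1 - lambda) * (n0%:R / lambda) :> R.
  by field; rewrite gt_eqF.
lra.
Qed.

End ExpectedVisits.

(** * Hoeffding's lemma *)

Section Hoeffding.
Context {R : realType}.

Lemma sinh_le_mul_cosh (x : R) : 0 <= x ->
  expR x - expR (- x) <= x * (expR x + expR (- x)).
Proof.
move=> x0; rewrite -subr_ge0.
pose f (y : R) := y * (expR y + expR (- y)) - (expR y - expR (- y)).
have df (y : R) : is_derive y 1 f (y * (expR y - expR (- y))).
  apply: is_derive_eq; rewrite /GRing.scale/=; ring.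
have -> : 0 = f 0 by rewrite /f oppr0; ring.
apply: (@ger0_derive1_ndecry _ f 0) => //.
- move=> y; rewrite in_itv/= andbT => y0.
  rewrite derive1E derive_val mulr_ge0 ?ltW// subr_gt0 ltr_expR; lra.
- apply: continuous_subspaceT => y.
  by apply: differentiable_continuous; apply/derivable1_diffP; exact: ex_derive.
Qed.

(** [exp (- y^2 / 2) cosh y] decreases on the nonnegative half-line, since
[tanh y <= y] there. *)
Lemma cosh_le_gauss (x : R) : (expR x + expR (- x)) / 2 <= expR (x ^+ 2 / 2).
Proof.
wlog x0 : x / 0 <= x.
  move=> H; have [/H//|/ltW x0] := leP 0 x.
  by have := H (- x); rewrite oppr_ge0 opprK sqrrN addrC; apply.
pose f (y : R) := expR (- (y ^+ 2 / 2)) * (expR y + expR (- y)).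
have df (y : R) : is_derive y 1 f
    (expR (- (y ^+ 2 / 2)) * (expR y - expR (- y) - y * (expR y + expR (- y)))).
  by apply: is_derive_eq; rewrite /GRing.scale/=; field.
have f0 : f 0 = 2 by rewrite /f expr0n/= mul0r oppr0 expR0; ring.
have : f x <= 2.
  rewrite -f0; apply: (@ler0_derive1_nincry _ f 0) => //.
  - move=> y; rewrite in_itv/= andbT => y0.
    rewrite derive1E derive_val pmulr_rle0 ?expR_gt0// subr_le0.
    exact/sinh_le_mul_cosh/ltW.
  - apply: continuous_subspaceT => y.
    by apply: differentiable_continuous; apply/derivable1_diffP; exact: ex_derive.
by rewrite /f expRN mulrC ler_pdivrMr ?expR_gt0// ler_pdivrMr// mulrC.
Qed.

(** Convexity of the exponential on [[- c, c]]: the right-hand side is the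
chord, and each endpoint value is bounded below by the tangent at [s t]. *)
Lemma expR_le_chord (s c t : R) : 0 < c -> `|t| <= c ->
  expR (s * t) <= (expR (s * c) + expR (- (s * c))) / 2 +
                  (expR (s * c) - expR (- (s * c))) / (2 * c) * t.
Proof.
move=> c0; rewrite ler_norml => /andP[tc1 tc2].
have tangent y : expR (s * t) * (1 + (y - s * t)) <= expR y.
  have -> : expR y = expR (s * t) * expR (y - s * t) by rewrite -expRD addrC subrK.
  rewrite ler_pM2l ?expR_gt0//.
  exact: expR_ge1Dx.
have := tangent (s * c); have := tangent (- (s * c)).
set a := expR (s * c); set b := expR (- (s * c)); set e := expR (s * t).
move=> Hb Ha.
have -> : (a + b) / 2 + (a - b) / (2 * c) * t =
          (2 * c)^-1 * (a * (c + t) + b * (c - t)).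
  by field; rewrite gt_eqF.
have -> : e = (2 * c)^-1 * (e * (1 + (s * c - s * t)) * (c + t) +
                           e * (1 + (- (s * c) - s * t)) * (c - t)).
  by field; rewrite gt_eqF.
rewrite ler_pM2l ?invr_gt0 ?mulr_gt0//.
by apply: lerD; apply: ler_wpM2r => //; lra.
Qed.

(** The values of [u] lie within [c] of its mean, so the exponential is below
its chord over [[- c, c]] around the mean. The linear part of the chord
integrates to zero, which leaves [cosh (s c)]. *)
Lemma hoeffding_mgf d (T : measurableType d) (mu : {measure set T -> \bar R})
    (u : T -> R) (c s : R) :
  mu setT = 1%E -> measurable_fun [set: T] u -> 0 < c ->
  (forall x y, u x - u y <= c) ->
  (\int[mu]_x (expR (s * u x))%:E <=
    (expR (s * \int[mu]_x u x + (s * c) ^+ 2 / 2))%:E)%E.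
Proof.
move=> mu1 mfu c0 uc.
have iu : mu.-integrable setT (EFin \o u).
  exact: (integrable_le_cst mu1 mfu (osc_bounded uc)).
have ic a : mu.-integrable setT (EFin \o (fun=> a)).
  by apply: (integrable_le_cst mu1 (M := `|a|)).
set m := (\int[mu]_x u x)%R.
have um x : `|u x - m| <= c.
  rewrite ler_norml -lerN2 opprK opprB; apply/andP; split.
  - rewrite lerBlDl.
    have -> : u x + c = \int[mu]_y (u x + c) by rewrite Rintegral_cst// mu1 mulr1.
    by apply: le_Rintegral => // y _; rewrite -lerBlDl.
  - rewrite lerBlDr -lerBlDl.
    have -> : u x - c = \int[mu]_y (u x - c) by rewrite Rintegral_cst// mu1 mulr1.
    by apply: le_Rintegral => // y _; rewrite lerBlDr -lerBlDl.
pose C := (expR (s * c) + expR (- (s * c))) / 2.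
pose K := (expR (s * c) - expR (- (s * c))) / (2 * c).
pose w x := expR (s * m) * (C + K * (u x - m)).
have ew x : expR (s * u x) <= w x.
  have -> : s * u x = s * m + s * (u x - m) by ring.
  rewrite expRD ler_pM2l ?expR_gt0//.
  exact: expR_le_chord.
have ww x : w x = expR (s * m) * (C - K * m) + expR (s * m) * K * u x.
  by rewrite /w; ring.
apply: (@le_trans _ _ (\int[mu]_x (w x)%:E)%E).
  apply: ge0_le_integral => //.
  - apply/measurable_EFinP; apply: measurableT_comp => //.
    exact: measurable_funM.
  - apply/measurable_EFinP; apply: measurable_funM => //.
    apply: measurable_funD => //; apply: measurable_funM => //.
    exact: measurable_funB.
  - by move=> x _; rewrite lee_fin.
have iKu : mu.-integrable setT (EFin \o (fun x => expR (s * m) * K * u x)).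
  by apply: (@integrableZl _ _ _ _ _ measurableT _ (EFin \o u)).
have iw : mu.-integrable setT (EFin \o w).
  have -> : w = (fun x => expR (s * m) * (C - K * m) + expR (s * m) * K * u x).
    exact/funext.
  exact: (integrableD measurableT (ic (expR (s * m) * (C - K * m))) iKu).
have Rw : \int[mu]_x w x = expR (s * m) * C.
  rewrite (@eq_Rintegral _ _ _ mu setT
    (fun x => expR (s * m) * (C - K * m) + expR (s * m) * K * u x)) //.
  rewrite RintegralD// Rintegral_cst// mu1 mulr1 RintegralZl// -/m.
  ring.
rewrite -[leLHS]fineK; last exact: integrable_fin_num.
rewrite lee_fin [leLHS]Rw expRD ler_pM2l ?expR_gt0//.
exact: cosh_le_gauss.
Qed.

End Hoeffding.

(** * Exponential moments of the number of visits *)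

Section VisitCounts.
Context (disp : measure_display) (S : measurableType disp) (R : realType).
Variable P : R.-pker S ~> S.
Context (dO : measure_display) (O : measurableType dO) (Pr : probability O R).
Variable X : nat -> {RV Pr >-> S}.

Lemma history_preimage i n A : (i <= n)%N -> measurable A ->
  history X n (X i @^-1` A).
Proof. by move=> ilen mA; apply: sub_sigma_algebra; exists i, A. Qed.

Lemma history_measurable n B : history X n B -> measurable B.
Proof.
apply: smallest_sub; first exact: sigma_algebra_measurable.
by move=> _ [i [A [_ mA ->]]]; exact: measurable_funPTI.
Qed.

Lemma le_history m n : (m <= n)%N -> history X m `<=` history X n.
Proof.
move=> mn; apply: sub_sigma_algebra2 => B [i [A [im mA ->]]].
by exists i, A; split=> //; exact: leq_trans mn.
Qed.

Lemma historyI n B C : history X n B -> history X n C -> history X n (B `&` C).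
Proof.
have /(sigma_algebraP (fun A _ => @subsetT _ A))[_ _ _] :=
  smallest_sigma_algebra setT
    [set B | exists (i : nat) (A : set S),
       [/\ (i <= n)%N, measurable A & B = X i @^-1` A]].
exact.
Qed.

Lemma historyC n B : history X n B -> history X n (~` B).
Proof. by move=> HB; rewrite -setTD; exact: sigma_algebraCD. Qed.

Lemma markov_integral (k : nat) (B : set O) (u : S -> \bar R) :
  markov_chain P X -> history X k B ->
  measurable_fun [set: S] u -> (forall y, 0 <= u y)%E ->
  (\int[Pr]_(w in B) u (X k.+1 w) =
   \int[Pr]_(w in B) \int[P (X k w)]_y u y)%E.
Proof.
move=> mX HB mfu u0; have mB := history_measurable HB.
transitivity (\int[Pr]_(w in B) \int[\d_(X k.+1 w)]_y u y)%E.
  by apply: eq_integral => w _; rewrite integral_dirac// diracT mul1e.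
apply: eq_integral_mixture => //.
- by move=> A mA; exact: measurable_dirac_comp.
- move=> A mA.
  exact: (measurableT_comp (measurable_kernel P A mA) (measurable_funP (X k))).
- move=> A mA; rewrite -mX// setIC -integral_indic//.
  exact: measurable_funPTI.
Qed.

Variables (A : set S) (mA : measurable A).

Definition visits (k n : nat) (w : O) : R := \sum_(i < n) \1_A (X (k + i)%N w).

Lemma visitsS k n w : visits k n.+1 w = \1_A (X k w) + visits k.+1 n w.
Proof.
rewrite /visits big_ord_recl/= addn0; congr (_ + _).
by apply: eq_bigr => i _; rewrite /bump/= addnA addn1.
Qed.

Lemma measurable_visits k n : measurable_fun [set: O] (visits k n).
Proof.
apply: measurable_sum => i.
exact: (measurableT_comp (measurable_indic mA) (measurable_funP (X (k + i)%N))).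
Qed.

(** Induction on the length of the time window, for all starting times [k] and
all events of the history at once. Cutting [B] according to whether [X k] is in [A]
makes the factor [exp (s 1_A (X k))] constant, so conditional expectations
reduce to integrals over events. The induction hypothesis at [k+1], the Markov
property and Hoeffding's lemma applied to [H] under [P (X k, .)] then give one
more factor [exp ((s c)^2 / 2)]. The first step costs none, because [H 1] is the
indicator of [A] itself; that factor is left for the initial distribution. *)
Lemma visits_mgf_history (c s : R) : markov_chain P X -> 0 < c ->
  (forall m x y, expected_visits P A m x - expected_visits P A m y <= c) ->
  forall m k B, history X k B ->
  (\int[Pr]_(w in B) (expR (s * visits k m.+1 w))%:E <=
   \int[Pr]_(w in B) (expR (s * expected_visits P A m.+1 (X k w) +
                            m%:R * ((s * c) ^+ 2 / 2)))%:E)%E.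
Proof.
move=> mX c0 osc.
pose bound m x := expR (s * expected_visits P A m.+1 x + m%:R * ((s * c) ^+ 2 / 2)).
have mbound m : measurable_fun [set: S] (fun x => (bound m x)%:E).
  apply/measurable_EFinP; apply: measurableT_comp => //.
  apply: measurable_funD => //; apply: measurable_funM => //.
  exact: measurable_expected_visits.
have mvis k n : measurable_fun [set: O] (fun w => (expR (s * visits k n w))%:E).
  apply/measurable_EFinP; apply: measurableT_comp => //.
  by apply: measurable_funM => //; exact: measurable_visits.
have boundX0 m k w : (0 <= (bound m (X k w))%:E)%E by rewrite lee_fin expR_ge0.
have mboundX m k : measurable_fun [set: O] (fun w => (bound m (X k w))%:E).
  exact: (measurableT_comp (mbound m)).
change (forall m k B, history X k B ->
  (\int[Pr]_(w in B) (expR (s * visits k m.+1 w))%:E <=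
   \int[Pr]_(w in B) (bound m (X k w))%:E)%E).
elim=> [|m IH] k B HB; have mB := history_measurable HB.
  apply: ge0_le_integral => //; try exact: measurable_funTS.
  move=> w _; rewrite lee_fin /bound mul0r addr0 visitsS /visits big_ord0 addr0.
  by rewrite /expected_visits big_ord1 kpow0.
(* On [D] the indicator at time [k] is the constant [b]. *)
have fiber (D : set O) (b : R) : history X k D -> (forall w, D w -> \1_A (X k w) = b) ->
    (\int[Pr]_(w in D) (expR (s * visits k m.+2 w))%:E <=
     \int[Pr]_(w in D) (bound m.+1 (X k w))%:E)%E.
  move=> HD Db; have mD := history_measurable HD.
  pose step := fun w => \int[P (X k w)]_y expected_visits P A m.+1 y.
  apply: (@le_trans _ _
      ((expR (s * b))%:E * \int[Pr]_(w in D) (bound m (X k.+1 w))%:E)%E).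
    apply: (@le_trans _ _ ((expR (s * b))%:E *
        \int[Pr]_(w in D) (expR (s * visits k.+1 m.+1 w))%:E)%E); last first.
      by rewrite lee_pmul2l ?lte_fin ?expR_gt0//; apply: IH; exact: le_history HD.
    rewrite -ge0_integralZl//; last exact: measurable_funTS.
    rewrite le_eqVlt; apply/orP; left; apply/eqP/eq_integral => w.
    by rewrite inE => /Db wb; rewrite visitsS wb mulrDr expRD.
  rewrite (markov_integral mX HD (mbound m)); last first.
    by move=> y; rewrite lee_fin expR_ge0.
  have mPbound : measurable_fun D
      (fun w => \int[P (X k w)]_y (bound m y)%:E)%E.
    apply: measurable_funTS.
    have mPu : measurable_fun [set: S] (fun x => \int[P x]_y (bound m y)%:E)%E.
      apply: measurable_fun_integral_kernel => // [U mU|y].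
        exact: measurable_kernel.
      by rewrite lee_fin expR_ge0.
    exact: (measurableT_comp mPu).
  rewrite -ge0_integralZl//; last first.
    by move=> w _; apply: integral_ge0 => y _; rewrite lee_fin expR_ge0.
  apply: ge0_le_integral => //.
  - move=> w _; apply: mule_ge0; first by rewrite lee_fin expR_ge0.
    by apply: integral_ge0 => y _; rewrite lee_fin expR_ge0.
  - exact: measurable_funeM.
  - exact: measurable_funTS.
  move=> w Dw.
  have -> : (bound m.+1 (X k w))%:E = ((expR (s * b))%:E *
      ((expR (m%:R * ((s * c) ^+ 2 / 2)))%:E *
       (expR (s * step w + (s * c) ^+ 2 / 2))%:E))%E.
    rewrite -!EFinM -!expRD /bound expected_visitsS// Db// -/(step w).
    by rewrite -natr1; congr (expR _)%:E; ring.
  rewrite lee_pmul2l ?lte_fin ?expR_gt0//.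
  under eq_integral do rewrite /bound addrC expRD EFinM.
  rewrite ge0_integralZl//; last first.
    apply/measurable_EFinP; apply: measurableT_comp => //.
    by apply: measurable_funM => //; exact: measurable_expected_visits.
  rewrite lee_pmul2l ?lte_fin ?expR_gt0//.
  by apply: hoeffding_mgf => //; [exact: prob_kernel|exact: measurable_expected_visits].
have mXA : measurable (X k @^-1` A) by exact: measurable_funPTI.
have HXA : history X k (X k @^-1` A) by exact: history_preimage.
have BA : [disjoint B `&` X k @^-1` A & B `\` X k @^-1` A]%classic.
  by apply/disj_setPS => w [[_ ?] []].
rewrite -(setUIDK B (X k @^-1` A)).
have mI := measurableI _ _ mB mXA; have mDf := measurableD mB mXA.
rewrite !ge0_integral_setU//; try exact: measurable_funTS.
apply: leeD; [apply: (fiber _ 1)|apply: (fiber _ 0)].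
- exact: historyI.
- by move=> w [_ Aw]; rewrite indicE mem_set.
- by rewrite setDE; apply: historyI => //; exact: historyC.
- by move=> w [_ Aw]; rewrite indicE memNset.
Qed.

End VisitCounts.

(** * Concentration of the number of visits, and order statistics *)

Section Concentration.
Context (disp : measure_display) (S : measurableType disp) (R : realType).
Variables (P : R.-pker S ~> S) (pi : probability S R).
Context (dO : measure_display) (O : measurableType dO) (Pr : probability O R).
Variable X : nat -> {RV Pr >-> S}.
Variables (A : set S) (mA : measurable A).

(** Hoeffding's lemma under the initial law [pi] is the last of the [n]
factors, and invariance makes the mean of [H n] equal to [n pi(A)]. *)
Lemma visits_mgf (c s : R) (n : nat) :
  markov_chain P X -> invariant_distribution P pi -> initial_law X pi ->
  0 < c ->
  (forall m x y, expected_visits P A m x - expected_visits P A m y <= c) ->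
  (\int[Pr]_w (expR (s * visits X A 0 n w))%:E <=
    (expR (n%:R * (s * fine (pi A) + (s * c) ^+ 2 / 2)))%:E)%E.
Proof.
move=> mX piP X0 c0 osc; case: n => [|n].
  under eq_integral do rewrite /visits big_ord0 mulr0 expR0.
  by rewrite integral_cst// mul1e mul0r expR0 [leLHS]probability_setT.
have HT : history X 0 setT.
  by rewrite -(preimage_setT (X 0%N)); exact: history_preimage.
apply: (le_trans (visits_mgf_history mA s mX c0 osc n HT)).
pose K := expR (n%:R * ((s * c) ^+ 2 / 2)).
have mH : measurable_fun [set: S] (expected_visits P A n.+1).
  exact: measurable_expected_visits.
have mu : measurable_fun [set: S] (fun x => (expR (s * expected_visits P A n.+1 x))%:E).
  by apply/measurable_EFinP; apply: measurableT_comp => //; exact: measurable_funM.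
under eq_integral do rewrite addrC expRD EFinM -/K.
rewrite ge0_integralZl//; last 2 first.
- exact: (measurableT_comp mu (measurable_funP (X 0%N))).
- by rewrite lee_fin expR_ge0.
have -> : (\int[Pr]_w (expR (s * expected_visits P A n.+1 (X 0%N w)))%:E =
    \int[pi]_x (expR (s * expected_visits P A n.+1 x))%:E)%E.
  rewrite -(@ge0_integral_distribution _ _ _ _ _ _ _
    (fun x => (expR (s * expected_visits P A n.+1 x))%:E))//.
    by apply: eq_measure_integral => B mB _; exact: X0.
have -> : n.+1%:R * (s * fine (pi A) + (s * c) ^+ 2 / 2) =
    n%:R * ((s * c) ^+ 2 / 2) +
    (s * \int[pi]_x expected_visits P A n.+1 x + (s * c) ^+ 2 / 2).
  rewrite Rintegral_expected_visits; [|by []|exact: probability_setT].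
  under eq_bigr do rewrite invariant_kpow//.
  by rewrite sumr_const card_ord -mulr_natl -natr1; ring.
rewrite expRD EFinM lee_pmul2l ?lte_fin ?expR_gt0//.
by apply: hoeffding_mgf => //; exact: probability_setT.
Qed.

(** Chernoff's bound at the minimizer [s = t / c^2] of
[- s n t + n (s c)^2 / 2]. *)
Lemma visits_concentration (c t : R) (n : nat) :
  markov_chain P X -> invariant_distribution P pi -> initial_law X pi ->
  0 < c ->
  (forall m x y, expected_visits P A m x - expected_visits P A m y <= c) ->
  0 < t ->
  (Pr [set w | (n%:R * (fine (pi A) + t) <= visits X A 0 n w)%R] <=
    (expR (- (n%:R * (t / c) ^+ 2 / 2)))%:E)%E.
Proof.
move=> mX piP X0 c0 osc t0.
pose s := t / c ^+ 2.
have s0 : 0 < s by rewrite divr_gt0// exprn_gt0.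
have @V : {mfun O >-> R} := HB.pack (visits X A 0 n)
  (isMeasurableFun.Build _ _ _ _ (visits X A 0 n) (measurable_visits X mA 0 n)).
apply: (le_trans (chernoff (P := Pr) V _ s0)).
rewrite -[(expR (- (n%:R * (t / c) ^+ 2 / 2)))](mulfK (lt0r_neq0 (expR_gt0
   (s * (n%:R * (fine (pi A) + t)))))).
rewrite -expRN EFinM; apply: lee_wpmul2r; first by rewrite lee_fin expR_ge0.
rewrite /mmt_gen_fun unlock.
have := visits_mgf s n mX piP X0 c0 osc.
rewrite -expRD.
have -> : - (n%:R * (t / c) ^+ 2 / 2) + s * (n%:R * (fine (pi A) + t)) =
   n%:R * (s * fine (pi A) + (s * c) ^+ 2 / 2).
  by rewrite /s; field; rewrite gt_eqF.
apply: le_trans; rewrite le_eqVlt; apply/orP; left; apply/eqP/eq_integral => w _.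
by rewrite /= mulrC.
Qed.

End Concentration.

Section OrderStatistics.
Context (R : realType) (O : Type) (Y : nat -> O -> R).
Implicit Types (n j : nat) (t : R) (w : O).

Lemma lt_order_statistic n j t w : (0 < j <= n)%N ->
  (t < order_statistic Y n j w) =
  (count (fun i => (Y i w <= t)%R) (iota 0 n) < j)%N.
Proof.
case: j => // j /= jn; rewrite /order_statistic/=.
set l := [seq Y i w | i <- iota 0 n].
have sl : sorted <=%O (sort <=%R l) by exact: sort_le_sorted.
have -> : count (fun i => (Y i w <= t)%R) (iota 0 n) = count (<= t) (sort <=%R l).
  by rewrite count_sort count_map.
have sz : size (sort <=%R l) = n by rewrite size_sort size_map size_iota.
rewrite ltnS; apply/idP/idP; last first.
  by move=> h; apply: nth_count_gt => //; rewrite h sz.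
by apply: contraTT; rewrite -ltnNge -leNgt; exact: nth_count_le.
Qed.

Lemma order_statistic_lt n j t w : (0 < j <= n)%N ->
  (order_statistic Y n j w < t) =
  (j <= count (fun i => (Y i w < t)%R) (iota 0 n))%N.
Proof.
case: j => // j /= jn; rewrite /order_statistic/=.
set l := [seq Y i w | i <- iota 0 n].
have sl : sorted <=%O (sort <=%R l) by exact: sort_le_sorted.
have sz : size (sort <=%R l) = n by rewrite size_sort size_map size_iota.
have -> : count (fun i => (Y i w < t)%R) (iota 0 n) = count (< t) (sort <=%R l).
  by rewrite count_sort count_map.
apply/idP/idP; last exact: nth_count_lt.
apply: contraTT; rewrite -ltnNge ltnS -leNgt => h.
by apply: nth_count_ge => //; rewrite h sz.
Qed.

End OrderStatistics.

(** * The distribution function near the quantile *)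

Section Quantile.
Context (disp : measure_display) (S : measurableType disp) (R : realType).
Variables (pi : probability S R) (g : {RV pi >-> R}).

Lemma dfunE (v : R) : (dfun g v)%:E = cdf g v.
Proof. by rewrite /dfun fineK// fin_num_measure. Qed.

Lemma dfun_le (u v : R) : u <= v -> dfun g u <= dfun g v.
Proof. by move=> uv; rewrite -lee_fin !dfunE cdf_nondecreasing. Qed.

Lemma has_inf_dfun (q : R) : 0 < q < 1 -> has_inf [set v : R | q <= dfun g v].
Proof.
move=> /andP[q0 q1].
have cdf1 : dfun g v @[v --> +oo] --> (1 : R).
  exact: fine_cvg (cvg_cdfy1 g).
have cdf0 : dfun g v @[v --> -oo] --> (0 : R).
  exact: fine_cvg (cvg_cdfNy0 g).
split.
  by have [v qv] := filter_ex (cvgr_ge _ cdf1 _ q1); exists v.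
have [v vq] := filter_ex (cvgr_lt _ cdf0 _ q0).
exists v => u qu; rewrite leNgt; apply/negP => uv.
by have := le_lt_trans (le_trans qu (dfun_le (ltW uv))) vq; rewrite ltxx.
Qed.

Lemma dfun_lt_quantile (q v : R) : 0 < q < 1 -> v < quantile g q -> dfun g v < q.
Proof.
move=> /has_inf_dfun[_ lbq] vq; rewrite ltNge; apply/negP => qv.
by have := ge_inf lbq qv; rewrite leNgt vq.
Qed.

(** By definition of the infimum [F_V] reaches [q] before any point [a] to the
right of the quantile, and between [a] and a further point [b] it gains at least
[f (quantile g q) / 2 * (b - a)], where [b] is so close that the density stays
above half its value at the quantile. *)
Lemma dfun_gt_quantile (q : R) (f : R -> R) (v : R) : 0 < q < 1 -> continuous f ->
  has_density g f -> 0 < f (quantile g q) -> quantile g q < v -> q < dfun g v.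
Proof.
set x := quantile g q => q01 cf [f0 df] fx xv.
have mf : measurable_fun [set: R] (EFin \o f).
  by apply/measurable_EFinP; exact: continuous_measurable_fun.
have [e e0 fe] : exists2 e : R, 0 < e & forall y, x <= y <= x + e -> f x / 2 <= f y.
  have : \forall y \near x, f x / 2 < f y.
    by apply: (cvgr_gt _ (cf x)); rewrite ltr_pdivrMr// ltr_pMr// ltr1n.
  move=> /nbhs_ballP[e /= e0 fe]; exists (e / 2); first exact: divr_gt0.
  move=> y /andP[xy ye]; apply/ltW/fe; rewrite /ball/= distrC ger0_norm ?subr_ge0//.
  by move: e0 ye; lra.
pose b := Num.min v (x + e); pose a := (x + b) / 2.
have xb : x < b by rewrite /b lt_min xv ltrDl.
have [xa ab] : x < a /\ a < b by rewrite /a; split; lra.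
have /andP[bv be] : (b <= v) && (b <= x + e) by rewrite /b !ge_min !lexx orbT.
have [u qu ua] : exists2 u, q <= dfun g u & u < a.
  exact: inf_lt (proj1 (has_inf_dfun q01)) xa.
have : ((dfun g a + f x / 2 * (b - a))%:E <= (dfun g b)%:E)%E.
  have -> : (dfun g b)%:E =
      (\int[lebesgue_measure]_(t in `]-oo, a] `|` `]a, b]) (f t)%:E)%E.
    by rewrite df -itv_bndbnd_setU// bnd_simp ltW.
  rewrite EFinD df.
  rewrite ge0_integral_setU//=; first last.
  - by apply/disj_setPS => y [/=]; rewrite !in_itv/=; lra.
  - by move=> y _; rewrite lee_fin.
  - exact: measurable_funTS.
  apply: leeD => //.
  have -> : (f x / 2 * (b - a))%:E =
      (\int[lebesgue_measure]_(y in `]a, b]) (f x / 2)%:E)%E.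
    by rewrite integral_cst//= lebesgue_measure_itv/= lte_fin ab.
  apply: ge0_le_integral => //=.
  - by move=> y _; rewrite lee_fin divr_ge0.
  - exact: measurable_funTS.
  - by move=> y; rewrite in_itv/= => /andP[ay yb]; rewrite lee_fin fe//; lra.
rewrite lee_fin => /le_trans /(_ (dfun_le bv)); apply: lt_le_trans.
have := dfun_le (ltW ua); have : 0 < f x / 2 * (b - a).
  by rewrite mulr_gt0 ?divr_gt0 ?subr_gt0.
lra.
Qed.

End Quantile.

(** * Tails of the sample quantile *)

Section SampleQuantileTails.
Context (disp : measure_display) (S : measurableType disp) (R : realType).
Variables (P : R.-pker S ~> S) (pi : probability S R) (g : {RV pi >-> R}).
Context (dO : measure_display) (O : measurableType dO) (Pr : probability O R).
Variable X : nat -> {RV Pr >-> S}.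

Lemma visits_count (p : pred R) (n : nat) (w : O) :
  visits X [set y | p (g y)] 0 n w =
  (count (fun i => p (g (X i w))) (iota 0 n))%:R.
Proof.
rewrite -sum1_count big_mkcond natr_sum /index_iota/= -(subn0 n).
rewrite -/(index_iota 0 n) big_mkord subn0.
apply: eq_bigr => i _; rewrite indicE.
by rewrite (_ : (_ \in _) = p (g (X i w)))//; apply/idP/idP; rewrite inE.
Qed.

Lemma quantile_index_itv (n : nat) (q : R) : (0 < n)%N -> 0 < q < 1 ->
  (0 < quantile_index n q <= n)%N.
Proof.
move=> n0 /andP[q0 q1]; have /andP[] := quantile_indexP n q0.
set j := quantile_index n q => j1 nqj.
have n0' : 0 < n%:R :> R by rewrite ltr0n.
apply/andP; split.
  by rewrite -(ltr0n R) (lt_le_trans _ nqj)// mulr_gt0.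
by rewrite -ltnS -(ltr_nat R) -natr1; nra.
Qed.

Variables (q c gamma t : R) (n : nat).
Hypotheses (mX : markov_chain P X) (piP : invariant_distribution P pi)
  (X0 : initial_law X pi) (c0 : 0 < c) (gamma0 : 0 < gamma).
Hypothesis osc : forall A, measurable A -> forall m x y,
  expected_visits P A m x - expected_visits P A m y <= c.
Hypotheses (n0 : (0 < n)%N) (q01 : 0 < q < 1).

Let sq := sample_quantile (fun i v => g (X i v)) n q.

Let mgt : measurable [set y | t < g y].
Proof.
rewrite (_ : [set _ | _] = g @^-1` `]t, +oo[); first exact: measurable_funPTI.
by apply/seteqP; split=> x /=; rewrite in_itv/= andbT.
Qed.

Let mle : measurable [set y | g y <= t].
Proof.
rewrite (_ : [set _ | _] = g @^-1` `]-oo, t]); first exact: measurable_funPTI.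
by apply/seteqP; split=> x /=; rewrite in_itv.
Qed.

Let mlt : measurable [set y | g y < t].
Proof.
rewrite (_ : [set _ | _] = g @^-1` `]-oo, t[); first exact: measurable_funPTI.
by apply/seteqP; split=> x /=; rewrite in_itv.
Qed.

Lemma sample_quantile_gtE :
  [set w | t < sq w] = visits X [set y | g y <= t] 0 n @^-1`
    `]-oo, (quantile_index n q)%:R[.
Proof.
apply/seteqP; split=> w /=; rewrite in_itv/= (visits_count (<= t)) ltr_nat;
  by rewrite /sq /sample_quantile lt_order_statistic// quantile_index_itv.
Qed.

Lemma sample_quantile_ltE :
  [set w | sq w < t] = visits X [set y | g y < t] 0 n @^-1`
    `[(quantile_index n q)%:R, +oo[.
Proof.
apply/seteqP; split=> w /=; rewrite in_itv/= andbT (visits_count (< t)) ler_nat;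
  by rewrite /sq /sample_quantile order_statistic_lt// quantile_index_itv.
Qed.

Lemma measurable_sample_quantile_gt : measurable [set w | t < sq w].
Proof.
rewrite sample_quantile_gtE -[X in measurable X]setTI.
exact: (measurable_visits X mle).
Qed.

Lemma measurable_sample_quantile_lt : measurable [set w | sq w < t].
Proof.
rewrite sample_quantile_ltE -[X in measurable X]setTI.
exact: (measurable_visits X mlt).
Qed.

Let mvisits (A : set S) (r : R) : measurable A ->
  measurable [set w | r <= visits X A 0 n w].
Proof.
move=> mA; rewrite (_ : [set _ | _] = setT `&` visits X A 0 n @^-1` `[r, +oo[).
  exact: (measurable_visits X mA).
by rewrite setTI; apply/seteqP; split=> x /=; rewrite in_itv/= andbT.
Qed.

(** Fewer than [j] values at most [t] leave more than [n - n q] visits to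
[{g > t}], whose stationary probability is [1 - F_V t]. *)
Lemma sample_quantile_upper_tail : gamma <= dfun g t - q ->
  (Pr [set w | (t < sq w)%R] <= (expR (- (n%:R * (gamma / c) ^+ 2 / 2)))%:E)%E.
Proof.
move=> gF.
apply: le_trans (visits_concentration mgt n mX piP X0 c0 (osc mgt) gamma0).
rewrite le_measure ?inE//.
- exact: measurable_sample_quantile_gt.
- exact: mvisits.
move=> w; rewrite sample_quantile_gtE /= in_itv/= (visits_count (> t)).
rewrite (visits_count (<= t)) => cj.
have /andP[j1 _] : (quantile_index n q)%:R - 1 < n%:R * q <= _ :=
  quantile_indexP n (proj1 (andP q01)).
have -> : fine (pi [set y | t < g y]) = 1 - dfun g t.
  rewrite (_ : [set y | t < g y] = ~` (g @^-1` `]-oo, t])).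
    rewrite probability_setC//.
    by rewrite /dfun /cdf/= fineB// fin_num_measure.
  by apply/seteqP; split=> y /=; rewrite in_itv/= ltNge => /negP.
have cn : (count (fun i => (t < g (X i w))%R) (iota 0 n))%:R =
    n%:R - (count (fun i => (g (X i w) <= t)%R) (iota 0 n))%:R :> R.
  rewrite -[in n%:R](size_iota 0 n).
  rewrite -(count_predC (fun i => (g (X i w) <= t)%R) (iota 0 n)).
  rewrite natrD addrAC subrr add0r.
  by congr (_%:R); apply: eq_count => i /=; rewrite ltNge.
rewrite cn.
have : (count (fun i => (g (X i w) <= t)%R) (iota 0 n))%:R + 1 <=
       (quantile_index n q)%:R :> R.
  by rewrite natr1 ler_nat -(ltr_nat R).
have : 0 < n%:R :> R by rewrite ltr0n.
nra.
Qed.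

(** At least [j >= n q] visits are paid to [{g < t}], whose stationary
probability is at most [F_V t]. *)
Lemma sample_quantile_lower_tail : gamma <= q - dfun g t ->
  (Pr [set w | (sq w < t)%R] <= (expR (- (n%:R * (gamma / c) ^+ 2 / 2)))%:E)%E.
Proof.
move=> gF.
apply: le_trans (visits_concentration mlt n mX piP X0 c0 (osc mlt) gamma0).
rewrite le_measure ?inE//.
- exact: measurable_sample_quantile_lt.
- exact: mvisits.
move=> w; rewrite sample_quantile_ltE /= in_itv/= andbT; apply: le_trans.
have /andP[_ nqj] : (quantile_index n q)%:R - 1 < n%:R * q <= _ :=
  quantile_indexP n (proj1 (andP q01)).
have : fine (pi [set y | g y < t]) <= dfun g t.
  apply: fine_le; rewrite ?fin_num_measure//.
  rewrite le_measure ?inE//.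
  by move=> y /=; rewrite in_itv/=; exact: ltW.
have : 0 < n%:R :> R by rewrite ltr0n.
nra.
Qed.

End SampleQuantileTails.

Theorem theorem3 (R : realType) (d : nat) (d_ge1 : (1 <= d)%N)
    (X : set 'rV[R]_d) (x0 : X)
    (X_borel : measurable (X : set (borel 'rV[R]_d)))
    (pi : probability (borel (subset_space x0)) R)
    (pi_support : measure_support pi = setT)
    (P : R.-pker (borel (subset_space x0)) ~> (borel (subset_space x0)))
    (P_harris : harris_ergodic P pi)
    (dO : measure_display) (O : measurableType dO) (Pr : probability O R)
    (Xs : nat -> {RV Pr >-> (borel (subset_space x0))})
    (Xs_markov : markov_chain P Xs) (Xs_stationary : initial_law Xs pi)
    (g : {RV pi >-> R}) (q : R) (q_itv : 0 < q < 1)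
    (f : R -> R) (f_cont : continuous f) (f_density : has_density g f)
    (f_pos : 0 < f (quantile g q))
    (phi : probability (borel (subset_space x0)) R) (lambda : R) (n0 : nat)
    (lambda_gt0 : 0 < lambda) (n0_ge1 : (1 <= n0)%N)
    (P_minor : minorized P n0 lambda phi)
    (eps delta : R) (eps_gt0 : 0 < eps) (delta_itv : 0 < delta < 1) :
  let xi := quantile g q in
  let gamma := Num.min (dfun g (xi + eps) - q)
                       (delta * (q - dfun g (xi - eps))) in
  forall n : nat, 2 * n0%:R / (lambda * gamma) < n%:R ->
  (Pr [set w : O | (eps < `|sample_quantile (fun i v => g (Xs i v)) n q w - xi|)%R]
   <= (2 * expR (- (lambda ^+ 2 * (n%:R * gamma - 2 * n0%:R / lambda) ^+ 2
                    / (2 * n%:R * n0%:R ^+ 2))))%:E)%E.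
Proof.
move=> xi gamma n n_gt.
have [irr aper harris piP] := P_harris.
have /andP[q0 q1] := q_itv; have /andP[delta0 delta1] := delta_itv.
have n0_gt0 : 0 < n0%:R :> R by rewrite ltr0n.
have F_lo : dfun g (xi - eps) < q by apply: dfun_lt_quantile; rewrite // -/xi gtrBl.
have F_hi : q < dfun g (xi + eps).
  by apply: (dfun_gt_quantile q_itv f_cont f_density f_pos); rewrite -/xi ltrDl.
have gamma_gt0 : 0 < gamma by rewrite lt_min subr_gt0 F_hi mulr_gt0 ?subr_gt0.
have gamma_hi : gamma <= dfun g (xi + eps) - q by rewrite ge_min lexx.
have gamma_lo : gamma <= q - dfun g (xi - eps).
  by rewrite ge_min; apply/orP; right; rewrite ger_pMl ?subr_gt0// ltW.
have c_gt0 : 0 < n0%:R / lambda by rewrite divr_gt0.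
have n_gt0 : (0 < n)%N.
  rewrite -(ltr_nat R); apply: le_lt_trans n_gt.
  by rewrite divr_ge0 ?mulr_ge0 ?ler0n// ltW.
have osc A (mA : measurable A) :=
  expected_visits_osc mA lambda_gt0 n0_ge1 P_minor.
set sq := sample_quantile _ n q.
have -> : [set w | eps < `|sq w - xi|] =
    [set w | xi + eps < sq w] `|` [set w | sq w < xi - eps].
  have far w : (eps < `|sq w - xi|) = (xi + eps < sq w) || (sq w < xi - eps).
    by rewrite lter_normr; congr orb; apply/idP/idP; lra.
  by apply/seteqP; split=> w; rewrite /= far => /orP.
have mhi : measurable [set w | xi + eps < sq w].
  exact: measurable_sample_quantile_gt.
have mlo : measurable [set w | sq w < xi - eps].
  exact: measurable_sample_quantile_lt.
apply: (le_trans (measureU2 _ mhi mlo)).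
(* [x |-> x^2] is monotone between [n gamma - 2 c] and [n gamma]. *)
have tail : ((expR (- (n%:R * (gamma / (n0%:R / lambda)) ^+ 2 / 2)))%:E <=
  (expR (- (lambda ^+ 2 * (n%:R * gamma - 2 * n0%:R / lambda) ^+ 2 /
           (2 * n%:R * n0%:R ^+ 2))))%:E)%E.
  have nR : 0 < n%:R :> R by rewrite ltr0n.
  pose c := n0%:R / lambda.
  have gap : 0 <= n%:R * gamma - 2 * c <= n%:R * gamma.
    rewrite /c; apply/andP; split; last by lra.
    rewrite subr_ge0 -ler_pdivrMr// ltW// (le_lt_trans _ n_gt)//.
    by rewrite invfM mulrA !mulrA.
  rewrite lee_fin ler_expR lerN2.
  have -> : lambda ^+ 2 * (n%:R * gamma - 2 * n0%:R / lambda) ^+ 2 /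
      (2 * n%:R * n0%:R ^+ 2) = (n%:R * gamma - 2 * c) ^+ 2 / (2 * n%:R * c ^+ 2).
    by rewrite /c; field; rewrite !gt_eqF.
  have -> : n%:R * (gamma / c) ^+ 2 / 2 =
      (n%:R * gamma) ^+ 2 / (2 * n%:R * c ^+ 2).
    by field; rewrite !gt_eqF.
  rewrite ler_pM2r ?invr_gt0 ?mulr_gt0 ?exprn_gt0 ?invr_gt0//.
  by case/andP: gap => gap0 gap1; rewrite lerXn2r// nnegrE (le_trans gap0).
rewrite mulr_natl mulr2n EFinD.
apply: leeD; apply: (le_trans _ tail).
- exact: (sample_quantile_upper_tail Xs_markov piP Xs_stationary).
- exact: (sample_quantile_lower_tail Xs_markov piP Xs_stationary).
Qed.
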